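(* Let $N>1$ and $p>1$ be integers and $\mu>0$, and consider the distributed ridge regression problem with local objectives $F_1,\dots,F_N$ on $\mathbb R^{Np+1}$ and global objective $F=\frac1N\sum_{k=1}^NF_k$ defined in the context, with minimizer $\mathbf w^*$ of $F$. Run FedAvg with exact (non-stochastic) gradients, full device participation, $E$ local steps per round and constant learning rate $\eta>0$. (a) If $E=1$ (gradient descent) and $\eta$ is small enough, FedAvg converges to $\mathbf w^*$. (b) For every $E>1$, if $\eta$ is small enough, then FedAvg converges to a point $\widetilde{\mathbf w}^*$ which is sub-optimal (i.e. $\widetilde{\mathbf w}^*\ne\mathbf w^*$), and $$\|\widetilde{\mathbf w}^*-\mathbf w^*\|\ \ge\ \frac{(E-1)\eta}{16}\,\big\|\mathbf A_1\mathbf A_2\mathbf w^*\big\| .$$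
   Context: The matrices are in $\mathbb R^{(Np+1)\times(Np+1)}$. For $1\le k\le N$, $\mathbf B_k$ is the symmetric matrix with entries $(\mathbf B_k)_{i,j}=1$ if $i=j\in\{(k-1)p+1,\,kp+1\}$; $=2$ if $i=j$ and $(k-1)p+1<i<kp+1$; $=-1$ if $|i-j|=1$ and $i,j\in[(k-1)p+1,\,kp+1]$; $=0$ otherwise. Let $\mathbf E_{i,j}$ be the matrix whose only non-zero entry is a $1$ at position $(i,j)$. Set $\mathbf A_1=\mathbf B_1+\mathbf E_{1,1}$, $\mathbf A_k=\mathbf B_k$ for $2\le k\le N-1$, $\mathbf A_N=\mathbf B_N+\mathbf E_{Np+1,Np+1}$. Then $\mathbf A=\sum_{k=1}^N\mathbf A_k$ is the tridiagonal matrix with $2$ on the diagonal and $-1$ on the two adjacent diagonals. Let $\mathbf b_1=\mathbf b=\mathbf e_1=(1,0,\dots,0)^\top$ and $\mathbf b_2=\dots=\mathbf b_N=\mathbf 0$. The local objectives are $$F_k(\mathbf w)=\tfrac12\left[\mathbf w^\top\mathbf A_k\mathbf w-2\mathbf b_k^\top\mathbf w+\mu\|\mathbf w\|_2^2\right],$$ and the global objective is $F(\mathbf w)=\frac1N\sum_kF_k(\mathbf w)=\frac1{2N}[\mathbf w^\top\mathbf A\mathbf w-2\mathbf b^\top\mathbf w]+\frac\mu2\|\mathbf w\|_2^2$. FedAvg here: from an arbitrary starting point $\mathbf w_0$, in each round $t$ every device $k$ starts at $\mathbf w_t$, performs $E$ gradient steps $\mathbf w\leftarrow\mathbf w-\eta\nabla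 F_k(\mathbf w)$ to obtain $\mathbf w_{t}^{(k)}$, and then $\mathbf w_{t+1}=\frac1N\sum_{k=1}^N\mathbf w_t^{(k)}$. ''Converges to $\widetilde{\mathbf w}^*$'' means $\mathbf w_t\to\widetilde{\mathbf w}^*$ as the number of rounds $t\to\infty$. ''$\eta$ is small enough'' means $0<\eta\le\eta_0$ for some threshold $\eta_0>0$ that may depend on $N,p,\mu,E$. $\|\cdot\|$ is the Euclidean norm. *)

(* Defs.v *)
From HB Require Import structures.
From mathcomp Require Import all_boot all_order all_algebra.
From mathcomp Require Import all_classical all_reals all_analysis.

Set Implicit Arguments.
Unset Strict Implicit.
Unset Printing Implicit Defensive.
Import Order.TTheory GRing.Theory Num.Theory.
Import numFieldNormedType.Exports.
Local Open Scope classical_set_scope.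
Local Open Scope ring_scope.

(* The library norm `|w| on matrices is the sup norm, hence this definition. *)
Definition enorm (R : realType) (n : nat) (w : 'cV[R]_n) : R :=
  Num.sqrt (\sum_i w i ord0 ^+ 2).

Definition grad (R : realType) (n : nat) (f : 'cV[R]_n -> R) (w : 'cV[R]_n) :
    'cV[R]_n :=
  \col_i 'D_(delta_mx i ord0) f w.

Definition is_minimizer (R : realType) (n : nat) (f : 'cV[R]_n -> R)
    (w : 'cV[R]_n) : Prop :=
  forall v, f w <= f v.

(* Devices are numbered 1, ..., N. *)
Section FedAvg.
Context (R : realType) (n N : nat) (F : nat -> 'cV[R]_n -> R).

Definition global_obj (w : 'cV[R]_n) : R :=
  N%:R^-1 * \sum_(1 <= k < N.+1) F k w.

Definition local_run (E : nat) (eta : R) (k : nat) (w : 'cV[R]_n) : 'cV[R]_n :=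
  iter E (fun v => v - eta *: grad (F k) v) w.

Definition fedavg_round (E : nat) (eta : R) (w : 'cV[R]_n) : 'cV[R]_n :=
  N%:R^-1 *: \sum_(1 <= k < N.+1) local_run E eta k w.

Definition fedavg (E : nat) (eta : R) (w0 : 'cV[R]_n) (t : nat) : 'cV[R]_n :=
  iter t (fedavg_round E eta) w0.

End FedAvg.

Section RidgeInstance.
Context (R : realType) (N p : nat).

(* Ordinals start at 0, so the block [(k-1)p+1, kp+1] of 1-based row indices
   is [(k-1)p, kp] here. *)
Definition in_block (k : nat) (i : 'I_(N * p).+1) : bool :=
  ((k - 1) * p <= i <= k * p)%N.

Definition block_end (k : nat) (i : 'I_(N * p).+1) : bool :=
  (nat_of_ord i == (k - 1) * p)%N || (nat_of_ord i == k * p)%N.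

Definition B_mx (k : nat) : 'M[R]_((N * p).+1) :=
  \matrix_(i, j)
    if (i == j) && block_end k i then 1
    else if (i == j) && in_block k i then 2
    else if [&& (i.+1 == j :> nat) || (j.+1 == i :> nat),
                in_block k i & in_block k j] then -1
    else 0.

Definition A_mx (k : nat) : 'M[R]_((N * p).+1) :=
  B_mx k + (if k == 1%N then delta_mx ord0 ord0 else 0)
         + (if k == N then delta_mx ord_max ord_max else 0).

Definition b_vec (k : nat) : 'cV[R]_(N * p).+1 :=
  if k == 1%N then delta_mx ord0 ord0 else 0.

Definition ridge_obj (mu : R) (k : nat) (w : 'cV[R]_(N * p).+1) : R :=
  2^-1 * ((w^T *m A_mx k *m w) ord0 ord0
          - 2 * ((b_vec k)^T *m w) ord0 ord0
          + mu * enorm w ^+ 2).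

End RidgeInstance.

(* Main.v *)
(** Write H_k = A_k + mu I, r_k = H_k w* - b_k and lam = N mu, so that the r_k
    sum to zero.  A local run of E steps moves w by - eta S_k (H_k w - b_k), where
    S_k is the sum of the (I - eta H_k)^j for j < E.  The matrix A_k is weakly
    diagonally dominant, so for small eta a step contracts the sup norm by the
    factor 1 - eta mu; hence a round has a unique fixed point w~, which attracts
    every trajectory and solves sum_k S_k (H_k w - b_k) = 0.
    For E = 1 this is the stationarity of w*.
    For E > 1, S_k = E - eta C(E,2) H_k + O(eta^2) and z = w~ - w* give
      E (A + lam) z = eta C(E,2) sum_k H_k r_k + O(eta^2 + eta |z|).
    It suffices to read one row of this equation, the one just before the junction
    of the blocks 1 and 2 (row p, counting from 1).  There the left-hand side is at
    most E (4 + lam) |z|.  With d = w*_(p+1) - w*_(p+2), the recurrence satisfied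
    by the positive decreasing sequence w* shows that the row of sum_k H_k r_k is at
    least d (1 + lam^2 + lam^3 / 2), whereas A_1 A_2 w* = d (e_(p+1) - e_p) has norm
    sqrt 2 d.  The resulting inequality is strict, which absorbs the error terms. *)

Require Import Defs.
From HB Require Import structures.
From mathcomp Require Import all_boot all_order all_algebra.
From mathcomp Require Import all_classical all_reals all_analysis.
From mathcomp Require Import zify ring lra.
Import Order.TTheory GRing.Theory Num.Theory.
Import numFieldNormedType.Exports.
Local Open Scope classical_set_scope.
Local Open Scope ring_scope.

Set Implicit Arguments.
Unset Strict Implicit.
Unset Printing Implicit Defensive.

(** * Sup-norm estimates and first-order conditions for quadratics *)

Section MatrixNorm.
Context (R : realType).

Lemma ler_norm_entry m n (A : 'M[R]_(m.+1, n.+1)) i j : `|A i j| <= `|A|.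
Proof.
rewrite [leRHS]mx_normrE.
exact: (le_bigmax _ (fun ij => `|A ij.1 ij.2|) (i, j)).
Qed.

Lemma ler_mx_norm m n (A : 'M[R]_(m.+1, n.+1)) c :
  (forall i j, `|A i j| <= c) -> `|A| <= c.
Proof.
move=> Ac; rewrite [leLHS]mx_normrE; apply: bigmax_le => [|[i j] _]; last exact: Ac.
exact: le_trans (Ac ord0 ord0).
Qed.

Lemma ler_norm_mulmx m n q (A : 'M[R]_(m.+1, n.+1)) (B : 'M[R]_(n.+1, q.+1)) :
  `|A *m B| <= n.+1%:R * `|A| * `|B|.
Proof.
apply: ler_mx_norm => i j; rewrite mxE.
apply: le_trans (ler_norm_sum _ _ _) _.
apply: le_trans (ler_sum _ (G := fun=> `|A| * `|B|) _) _ => [k _|].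
  by rewrite normrM ler_pM ?ler_norm_entry.
by rewrite sumr_const card_ord -[leLHS]mulr_natl mulrA.
Qed.

Lemma enorm_sq n (w : 'cV[R]_n) : enorm w ^+ 2 = (w^T *m w) ord0 ord0.
Proof.
rewrite sqr_sqrtr; last by apply: sumr_ge0 => i _; exact: sqr_ge0.
by rewrite mxE; apply: eq_bigr => i _; rewrite mxE expr2.
Qed.

Lemma ler_norm_enorm n (w : 'cV[R]_n.+1) : `|w| <= enorm w.
Proof.
apply: ler_mx_norm => i j; rewrite ord1 -sqrtr_sqr ler_sqrt; last first.
  by apply: sumr_ge0 => k _; exact: sqr_ge0.
rewrite (bigD1 i) //= lerDl; apply: sumr_ge0 => k _; exact: sqr_ge0.
Qed.

Lemma unitmx_trivial_kernel n (A : 'M[R]_n) :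
  (forall x : 'cV_n, A *m x = 0 -> x = 0) -> A \in unitmx.
Proof.
move=> kerA; rewrite -unitmx_tr -row_free_unit -kermx_eq0.
apply/eqP/row_matrixP => i; rewrite row0.
apply: trmx_inj; rewrite trmx0; apply: kerA.
by apply: trmx_inj; rewrite trmx_mul trmxK trmx0 -row_mul mulmx_ker row0.
Qed.

(** For [h != 0] the difference quotient is exactly [c + h * e], which tends to [c]; gradients can
    thus be read off an algebraic expansion. *)
Lemma derive_quadratic n (f : 'cV[R]_n.+1 -> R) (a v : 'cV[R]_n.+1) (c e : R) :
  (forall t, f (a + t *: v) = f a + t * c + t ^+ 2 * e) -> 'D_v f a = c.
Proof.
move=> fE; rewrite /derive; apply: cvg_lim => //.
have lim0 : (fun h : R => c + h * e) @ 0^' --> c.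
  rewrite -[X in _ --> X]addr0; apply: cvgD; first exact: cvg_cst.
  rewrite -[X in _ --> X](mul0r e); apply: cvgMl.
  by apply: cvg_within_filter; exact: cvg_id.
apply: cvg_trans lim0; apply: near_eq_cvg.
near=> h.
have h0 : h != 0 by near: h; exact: nbhs_dnbhs_neq.
rewrite /= [h *: v + a]addrC fE /GRing.scale /=.
by field.
Unshelve. all: by end_near.
Qed.

Lemma linear_coef_eq0 (c e : R) : (forall t, 0 <= t * c + t ^+ 2 * e) -> c = 0.
Proof.
move=> ge0.
have d0 : 0 < `|e| + 1 by rewrite ltr_wpDl.
(* At this [t] the polynomial equals [c ^+ 2 * u * (e * u - 1)]. The denominator exceeds [e]
   whatever its sign, so the last factor is negative and [c ^+ 2 <= 0]. *)
have := ge0 (- c / (`|e| + 1)).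
set u := (`|e| + 1)^-1.
have -> : - c * u * c + (- c * u) ^+ 2 * e = c ^+ 2 * u * (e * u - 1) by ring.
have lt1 : e * u - 1 < 0.
  rewrite subr_lt0 /u ltr_pdivrMr // mul1r.
  by apply: le_lt_trans (ler_norm _) _; rewrite ltrDl.
rewrite nmulr_lge0 // pmulr_lle0 ?invr_gt0 // => c2.
by apply/eqP; rewrite -sqrf_eq0 eq_le c2 sqr_ge0.
Qed.

End MatrixNorm.

(** * FedAvg for objectives with affine gradients *)

Section QuadraticFedAvg.
Context (R : realType) (n N : nat) (F : nat -> 'cV[R]_n.+1 -> R).
Context (H : nat -> 'M[R]_n.+1) (b : nat -> 'cV[R]_n.+1).
Context (gradF : forall k w, grad (F k) w = H k *m w - b k).
Context (N_gt0 : (0 < N)%N).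

(* [geom eta A E] is the geometric sum of the powers [(1 - eta A)^j], j < E. *)
Definition geom (eta : R) (A : 'M[R]_n.+1) (E : nat) : 'M[R]_n.+1 :=
  iter E (fun X => 1%:M + (1%:M - eta *: A) *m X) 0.

Lemma geomS eta A E :
  geom eta A E.+1 = 1%:M + (1%:M - eta *: A) *m geom eta A E.
Proof. by []. Qed.

Lemma geom1 eta A : geom eta A 1 = 1%:M.
Proof. by rewrite geomS mulmx0 addr0. Qed.

Lemma local_runE E eta k w :
  local_run F E eta k w = w - eta *: (geom eta (H k) E *m (H k *m w - b k)).
Proof.
elim: E => [|E IH]; first by rewrite /= mul0mx scaler0 subr0.
rewrite [LHS]/local_run iterS -/(local_run F E eta k w) IH gradF geomS.
set g := H k *m w - b k; set S := geom eta (H k) E.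
(* The gradient is affine, so after the displacement [- eta *: (S *m g)] it is
   [g - eta *: (H k *m (S *m g))]; adding this to [S *m g] reproduces the recursion of [geom]. *)
have -> : H k *m (w - eta *: (S *m g)) - b k = g - eta *: (H k *m (S *m g)).
  by rewrite mulmxBr -scalemxAr /g addrAC.
rewrite mulmxBl mul1mx mulmxDl mul1mx mulmxBl -!scalemxAl -!mulmxA.
by rewrite -addrA -opprD -scalerDr addrA [S *m g + g]addrC -addrA.
Qed.

Lemma fedavg_roundE E eta w :
  fedavg_round N F E eta w =
  w - (eta / N%:R) *: \sum_(1 <= k < N.+1) geom eta (H k) E *m (H k *m w - b k).
Proof.
rewrite /fedavg_round; under eq_bigr do rewrite local_runE.
rewrite big_split /= sumr_const_nat subn1 /= sumrN -scaler_sumr scalerDr scalerN.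
rewrite scalerA [N%:R^-1 * eta]mulrC -[w *+ _]scaler_nat scalerA mulVf ?scale1r //.
by rewrite pnatr_eq0 -lt0n.
Qed.

Section Contraction.
Context (E : nat) (eta q : R) (E_gt0 : (0 < E)%N).
Context (q_ge0 : 0 <= q) (q_lt1 : q < 1).
Context (step_contr : forall k (x : 'cV[R]_n.+1), (1 <= k < N.+1)%N ->
  `|x - eta *: (H k *m x)| <= q * `|x|).

(** One factor [q] out of the [E] available is enough for a contraction; the other steps only need
    [q <= 1]. *)
Lemma local_run_contraction k x y : (1 <= k < N.+1)%N ->
  `|local_run F E eta k x - local_run F E eta k y| <= q * `|x - y|.
Proof.
move=> kN; case: E E_gt0 => // e _.
have iter_le : forall m, `|local_run F m.+1 eta k x - local_run F m.+1 eta k y|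
     <= q * `|local_run F m eta k x - local_run F m eta k y|.
  move=> m; rewrite /local_run !iterS -!/(local_run F m eta k _) !gradF.
  set u := local_run F m eta k x; set v := local_run F m eta k y.
  have -> : u - eta *: (H k *m u - b k) - (v - eta *: (H k *m v - b k))
      = (u - v) - eta *: (H k *m (u - v)).
    rewrite mulmxBr !scalerBr !opprB !addrA.
    by apply/matrixP => i j; rewrite !mxE; ring.
  exact: step_contr.
elim: e => [|e IH]; first exact: iter_le.
apply: le_trans (iter_le _) _; apply: le_trans IH.
by apply: ler_piMl => //; exact: ltW.
Qed.

Lemma fedavg_round_contraction x y :
  `|fedavg_round N F E eta x - fedavg_round N F E eta y| <= q * `|x - y|.
Proof.
rewrite /fedavg_round -scalerBr -sumrB normrZ ger0_norm ?invr_ge0 //.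
rewrite mulrC ler_pdivrMr ?ltr0n //.
apply: le_trans (ler_norm_sum _ _ _) _.
apply: le_trans (ler_sum_nat (G := fun=> q * `|x - y|) _) _ => [k kN|].
  exact: local_run_contraction.
by rewrite sumr_const_nat subn1 /= mulr_natr.
Qed.

(** The hypothesis says that [w] is fixed by a round, so each round multiplies the distance to [w]
    by at most [q]. *)
Lemma fedavg_cvg w0 w :
    \sum_(1 <= k < N.+1) geom eta (H k) E *m (H k *m w - b k) = 0 ->
  fedavg N F E eta w0 @ \oo --> w.
Proof.
move=> w_fix.
have round_w : fedavg_round N F E eta w = w.
  by rewrite fedavg_roundE w_fix scaler0 subr0.
have dist_le t : `|w - fedavg N F E eta w0 t| <= q ^+ t * `|w - w0|.
  elim: t => [|t IH]; first by rewrite mul1r.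
  rewrite /fedavg iterS -/(fedavg N F E eta w0 t) -{1}round_w exprS -mulrA.
  by apply: le_trans (fedavg_round_contraction _ _) _; rewrite ler_wpM2l.
apply/cvgrPdist_le => e e_gt0.
have q_cvg : (fun t : nat => q ^+ t * `|w - w0|) @ \oo --> (0 : R).
  rewrite -[X in _ --> X](mul0r `|w - w0|); apply: cvgMl.
  by apply: cvg_expr; rewrite ger0_norm.
near=> t; apply: le_trans (dist_le t) _.
near: t; move/cvgrPdist_le : q_cvg => /(_ _ e_gt0); apply: filterS => t.
by rewrite sub0r normrN; apply: le_trans; exact: ler_norm.
Unshelve. all: by end_near.
Qed.

(** Since the round is affine, existence is linear algebra: if [G *m x = 0], the images of [x] and
    [0] under a round are as far apart as [x] and [0], and contraction forces [x = 0]. Hence [G] is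
    invertible. *)
Lemma fixed_point_exists :
  exists w, \sum_(1 <= k < N.+1) geom eta (H k) E *m (H k *m w - b k) = 0.
Proof.
pose G := \sum_(1 <= k < N.+1) geom eta (H k) E *m H k.
have GE w : \sum_(1 <= k < N.+1) geom eta (H k) E *m (H k *m w - b k)
    = G *m w - \sum_(1 <= k < N.+1) geom eta (H k) E *m b k.
  rewrite /G mulmx_suml -sumrB; apply: eq_bigr => k _.
  by rewrite mulmxBr mulmxA.
have G_unit : G \in unitmx.
  apply: unitmx_trivial_kernel => x Gx0.
  have := fedavg_round_contraction x 0; rewrite !fedavg_roundE !GE Gx0 mulmx0.
  rewrite [0 - (_ *: _)]sub0r opprK subrK subr0 -subr_le0.
  rewrite -{1}[`|x|]mul1r -mulrBl pmulr_rle0 ?subr_gt0 //.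
  by rewrite normr_le0 => /eqP.
exists (invmx G *m \sum_(1 <= k < N.+1) geom eta (H k) E *m b k).
by rewrite GE mulKVmx // subrr.
Qed.

End Contraction.

(** The constant depends on [E], [h] and the dimension but not on [A] or [eta], which allows a
    single threshold for the learning rate later. *)
Lemma geom_expansion E (h : R) : 0 <= h -> exists C : R, 0 <= C /\
  forall (A : 'M[R]_n.+1) eta, `|A| <= h -> 0 <= eta -> eta <= 1 ->
  `|geom eta A E - (E%:R%:M - (eta * 'C(E, 2)%:R) *: A)| <= C * eta ^+ 2.
Proof.
move=> h_ge0; elim: E => [|E [C [C_ge0 IH]]].
  exists 0; split=> // A eta _ _ _.
  by rewrite mulr0 scale0r subr0 raddf0 subr0 normr0 mul0r.
exists (C + n.+1%:R * h * C + 'C(E, 2)%:R * (n.+1%:R * h * h)).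
split=> [|A eta Ah eta0 eta1]; first by rewrite !addr_ge0 ?mulr_ge0.
have {}IH := IH A eta Ah eta0 eta1.
set X := geom eta A E - _ in IH.
(* Pascal's rule makes the terms of order 0 and 1 match, leaving a recursion for the remainder [X]
   whose only new contribution is of order [eta ^+ 2]. *)
have -> : geom eta A E.+1 - (E.+1%:R%:M - (eta * 'C(E.+1, 2)%:R) *: A)
  = X - eta *: (A *m X) + (eta ^+ 2 * 'C(E, 2)%:R) *: (A *m A).
  rewrite geomS; have -> : geom eta A E = E%:R%:M - (eta * 'C(E, 2)%:R) *: A + X.
    by rewrite /X addrC subrK.
  rewrite mulmxBl mul1mx -scalemxAl mulmxDr mulmxBr mul_mx_scalar -scalemxAr.
  rewrite binS bin1 natrD -[E.+1]addn1 natrD.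
  by apply/matrixP => i j; rewrite !mxE; case: (i == j); rewrite ?mulr1n ?mulr0n; ring.
have AX : `|A *m X| <= n.+1%:R * h * (C * eta ^+ 2).
  apply: le_trans (ler_norm_mulmx _ _) _.
  by rewrite ler_pM ?mulr_ge0 ?ler_wpM2l.
have AA : `|A *m A| <= n.+1%:R * h * h.
  apply: le_trans (ler_norm_mulmx _ _) _.
  by rewrite ler_pM ?mulr_ge0 ?ler_wpM2l.
apply: le_trans (ler_normD _ _) _; rewrite !mulrDl; apply: lerD.
  apply: le_trans (ler_normB _ _) _; apply: lerD => //.
  rewrite normrZ ger0_norm //; apply: le_trans (ler_piMl _ eta1) _ => //.
  by rewrite -mulrA.
rewrite normrZ ger0_norm ?mulr_ge0 ?exprn_ge0 //.
by rewrite [leRHS]mulrC -[leLHS]mulrA !ler_wpM2l ?mulr_ge0 ?exprn_ge0.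
Qed.

Lemma fixed_point_expansion E (h : R) (w : 'cV[R]_n.+1) :
    (forall k, (1 <= k < N.+1)%N -> `|H k| <= h) ->
    \sum_(1 <= k < N.+1) (H k *m w - b k) = 0 ->
  exists C : R, 0 <= C /\ forall eta z, 0 <= eta -> eta <= 1 ->
    \sum_(1 <= k < N.+1) geom eta (H k) E *m (H k *m (w + z) - b k) = 0 ->
  `|E%:R *: (\sum_(1 <= k < N.+1) H k *m z)
    - (eta * 'C(E, 2)%:R) *: \sum_(1 <= k < N.+1) H k *m (H k *m w - b k)|
  <= C * (eta ^+ 2 + eta * `|z|).
Proof.
move=> Hh r_sum0; pose r k := H k *m w - b k.
have h_ge0 : 0 <= h by apply: le_trans (Hh 1%N _) => //; rewrite ltnS.
have [C0 [C0_ge0 geomC]] := geom_expansion E h_ge0.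
pose rho : R := \sum_(1 <= k < N.+1) `|r k|.
have rho_ge0 : 0 <= rho by apply: sumr_ge0.
have r_le k : (1 <= k < N.+1)%N -> `|r k| <= rho.
  move=> kN; rewrite /rho (bigD1_seq k) ?mem_index_iota ?iota_uniq //=.
  by rewrite lerDl sumr_ge0.
pose d : R := n.+1%:R; have d_ge0 : 0 <= d by [].
pose C1 : R := 'C(E, 2)%:R * (d * h * (d * h)) + d * C0 * (d * h).
pose C := N%:R * (C1 + d * C0 * rho).
exists C; split=> [|eta z eta0 eta1 fix_eq]; first by rewrite !(mulr_ge0, addr_ge0).
pose X k := geom eta (H k) E - (E%:R%:M - (eta * 'C(E, 2)%:R) *: H k).
pose D k := (eta * 'C(E, 2)%:R) *: (H k *m (H k *m z)) - X k *m (H k *m z + r k).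
have -> : E%:R *: (\sum_(1 <= k < N.+1) H k *m z)
    - (eta * 'C(E, 2)%:R) *: \sum_(1 <= k < N.+1) H k *m (H k *m w - b k)
    = \sum_(1 <= k < N.+1) D k.
  (* The two terms added here sum to zero over [k]: the multiples of [r k] by stationarity of [w],
     the [geom] terms by the fixed-point equation. Termwise, the parts of order 0 and 1 then cancel,
     except for [H k *m (H k *m z)], which is already of order [eta * |z|]. *)
  pose T k := E%:R *: (H k *m z) - (eta * 'C(E, 2)%:R) *: (H k *m r k)
    + E%:R *: r k - geom eta (H k) E *m (H k *m (w + z) - b k).
  transitivity (\sum_(1 <= k < N.+1) T k).
    by rewrite sumrB fix_eq big_split /= sumrB -!scaler_sumr r_sum0 scaler0 addr0 subr0.
  apply: eq_bigr => k _; rewrite /T /D.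
  have -> : H k *m (w + z) - b k = H k *m z + r k.
    by rewrite mulmxDr [H k *m w + _]addrC -addrA.
  have -> : geom eta (H k) E = E%:R%:M - (eta * 'C(E, 2)%:R) *: H k + X k.
    by rewrite /X addrC subrK.
  rewrite [(_ + X k) *m _]mulmxDl mulmxBl mul_scalar_mx -scalemxAl !mulmxDr !scalerDr.
  by apply/matrixP => i j; rewrite !mxE; ring.
apply: le_trans (ler_norm_sum _ _ _) _.
apply: le_trans (ler_sum_nat
  (G := fun=> (C1 + d * C0 * rho) * (eta ^+ 2 + eta * `|z|)) _) _ => [k kN|]; last first.
  by rewrite sumr_const_nat subn1 /= -mulr_natl mulrA.
have Hk := Hh k kN.
have Hz : `|H k *m z| <= d * h * `|z|.
  by apply: le_trans (ler_norm_mulmx _ _) _; rewrite ler_wpM2r // ler_wpM2l.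
have HHz : `|H k *m (H k *m z)| <= d * h * (d * h * `|z|).
  by apply: le_trans (ler_norm_mulmx _ _) _; rewrite ler_pM ?mulr_ge0 // ler_wpM2l.
have Xr : `|X k *m (H k *m z + r k)| <= d * (C0 * eta ^+ 2) * (d * h * `|z| + rho).
  apply: le_trans (ler_norm_mulmx _ _) _; rewrite ler_pM ?mulr_ge0 //.
    by rewrite ler_wpM2l // geomC.
  by apply: le_trans (ler_normD _ _) _; rewrite lerD // r_le.
have cHHz : `|(eta * 'C(E, 2)%:R) *: (H k *m (H k *m z))|
    <= eta * 'C(E, 2)%:R * (d * h * (d * h * `|z|)).
  by rewrite normrZ ger0_norm ?mulr_ge0 // ler_wpM2l ?mulr_ge0.
apply: le_trans (ler_normB _ _) _; apply: le_trans (lerD cHHz Xr) _.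
have eta2 : eta ^+ 2 * `|z| <= eta * `|z|.
  by rewrite ler_wpM2r // expr2 ler_piMl.
have C1_ge0 : 0 <= C1 by rewrite !(mulr_ge0, addr_ge0).
rewrite -subr_ge0.
rewrite [leRHS](_ : _ = C1 * eta ^+ 2 + d * C0 * (d * h) * (eta * `|z| - eta ^+ 2 * `|z|)
  + d * C0 * rho * (eta * `|z|)); last by rewrite /C1; ring.
apply: addr_ge0; last by rewrite !mulr_ge0.
by apply: addr_ge0; rewrite mulr_ge0 ?sqr_ge0 ?subr_ge0 ?mulr_ge0.
Qed.

End QuadraticFedAvg.

(** * A three-term recurrence with a vanishing end value *)

(** Backward induction from the end: the recurrence reads [U i - U i.+1 = lam * U i.+1 + (U i.+1 - U
    i.+2)], so nonnegativity and strict decrease pass from [i.+1] to [i]. *)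
Lemma decreasing_recurrence (R : realType) (lam : R) (U : nat -> R) (m : nat) :
    0 <= lam -> 0 < U 0%N -> U m.+1 = 0 ->
    (forall i, (i < m)%N -> (2 + lam) * U i.+1 = U i + U i.+2) ->
  forall i, (i <= m)%N -> 0 <= U i.+1 < U i.
Proof.
move=> lam0 U0 Um rec.
have back P : P m -> (forall i, (i < m)%N -> P i.+1 -> P i) ->
    forall i, (i <= m)%N -> P i.
  move=> Pm PS i im; rewrite -(subKn im); elim: (m - i)%N (leq_subr i m) => [|j IH] jm.
    by rewrite subn0.
  by apply: PS; [lia | rewrite subnSK //; apply: IH; lia].
(* Otherwise the same induction with reversed signs would carry [U i <= U i.+1 <= 0] down to
   [U 0 <= 0]. *)
have Um_gt0 : 0 < U m.
  rewrite ltNge; apply/negP => Um_le0.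
  suff /(_ 0%N isT)/andP[] : forall i, (i <= m)%N -> U i <= U i.+1 <= 0 by lra.
  apply: (back (fun i => U i <= U i.+1 <= 0)) => [|i /rec reci /andP[Ui1 Ui2]].
    by rewrite Um lexx andbT.
  have : lam * U i.+1 <= 0 by rewrite mulr_ge0_le0 //; lra.
  by lra.
apply: (back (fun i => 0 <= U i.+1 < U i)) => [|i /rec reci /andP[Ui1 Ui2]].
  by rewrite Um lexx.
have : 0 <= lam * U i.+1 by rewrite mulr_ge0 //; lra.
by lra.
Qed.

(** * Edge description of the matrices [A_mx] *)

Section Ridge.
Context (R : realType) (N p : nat).
Local Notation n := (N * p)%N.
Implicit Types (w x z : 'cV[R]_n.+1) (k : nat).

(* The coordinates of [w] numbered from 1 and extended by [0] on both sides. *)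
Definition ext w (m : nat) : R := \sum_(j < n.+1) (j.+1 == m)%:R * w j ord0.

Lemma ext_ord w (i : 'I_n.+1) : ext w i.+1 = w i ord0.
Proof.
rewrite /ext (bigD1 i) //= eqxx mul1r big1 ?addr0 // => j ji.
by rewrite eqSS (negbTE (ji : (j : nat) != i)) mul0r.
Qed.

Lemma ext0 w : ext w 0 = 0.
Proof. by rewrite /ext big1 // => j _; rewrite mul0r. Qed.

Lemma ext_out w m : (n.+1 < m)%N -> ext w m = 0.
Proof.
move=> nm; rewrite /ext big1 // => j _.
by rewrite (_ : _ == _ = false) ?mul0r //; apply/eqP; have := ltn_ord j; lia.
Qed.

Lemma ler_norm_ext w m : `|ext w m| <= `|w|.
Proof.
case: m => [|m]; first by rewrite ext0 normr0.
have [mn|nm] := ltnP m n.+1; last by rewrite ext_out ?normr0.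
by rewrite (ext_ord w (Ordinal mn)) ler_norm_entry.
Qed.

(* Whether row [i] of [A_mx k] has an edge to its successor, resp. predecessor;
   the two corner corrections count as edges to coordinates outside the range. *)
Definition fwd k (i : nat) : bool := ((k - 1) * p <= i < k * p + (k == N))%N.
Definition bwd k (i : nat) : bool := ((k - 1) * p + (k != 1%N) <= i <= k * p)%N.

Context (hN : (1 < N)%N) (hp : (1 < p)%N).

Lemma A_mxE k (i j : 'I_n.+1) : (1 <= k < N.+1)%N ->
  A_mx R N p k i j =
    (fwd k i)%:R * ((j.+1 == i.+1)%:R - (j.+1 == i.+2)%:R)
    + (bwd k i)%:R * ((j.+1 == i.+1)%:R - (j.+1 == i)%:R).
Proof.
move=> /andP[k1 kN].
have del (c : 'I_n.+1) (P : bool) :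
   (if P then delta_mx c c else 0 : 'M[R]_n.+1) i j
   = [&& P, (i : nat) == c & (j : nat) == c]%:R.
  by case: P; rewrite !mxE.
rewrite /A_mx 2![in LHS]mxE !del !mxE -val_eqE /fwd /bwd /block_end /in_block /=.
(* Stating the tests on [k] through the block ends lets the products be generalized to [lo], [hi]
   and [m], so that the remaining case analysis is linear arithmetic. *)
have -> : (k == 1%N) = ((k - 1) * p == 0)%N by rewrite muln_eq0; lia.
have -> : (k == N) = (k * p == N * p)%N by rewrite eqn_pmul2r; lia.
have : (k * p <= N * p)%N by rewrite leq_mul2r; lia.
have : ((k - 1) * p + 1 < k * p)%N by rewrite -{2}(subnK k1) mulnDl mul1n ltn_add2l.
move: (ltn_ord i) (ltn_ord j).
move: (nat_of_ord i) (nat_of_ord j); clear i j del.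
move: ((k - 1) * p)%N (k * p)%N (N * p)%N; clear.
move=> lo hi m i j im jm lo_hi hi_m; rewrite !eqSS.
have [ij|ji|<-] := ltngtP i j.
- have -> : (j.+1 == i) = false by lia.
  have -> : (i == 0)%N && (j == 0)%N = false by lia.
  have -> : (i == m) && (j == m) = false by lia.
  rewrite !andbF orbF [j == _]eq_sym; have [jE|_] := eqVneq i.+1 j; last by rewrite /=; ring.
  have -> : (lo <= i <= hi)%N && (lo <= j <= hi)%N = (lo <= i < hi + (hi == m))%N by lia.
  by rewrite /=; case: (_ <= _ < _)%N; rewrite /=; ring.
- have -> : (i.+1 == j) = false by lia.
  have -> : (j == i.+1) = false by lia.
  have -> : (i == 0)%N && (j == 0)%N = false by lia.
  have -> : (i == m) && (j == m) = false by lia.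
  rewrite !andbF /=; have [jE|_] := eqVneq j.+1 i; last by rewrite /=; ring.
  have -> : (lo <= i <= hi)%N && (lo <= j <= hi)%N = (lo + (lo != 0) <= i <= hi)%N by lia.
  by rewrite /=; case: (_ <= _ <= _)%N; rewrite /=; ring.
have -> : (i == i.+1) = false by lia.
have -> : (i.+1 == i) = false by lia.
rewrite !andbb /=; have [i_lo|lo_i|i_lo] := ltngtP i lo.
- have -> : (i == hi) = false by lia.
  have -> : (lo == 0)%N && (i == 0)%N = false by lia.
  have -> : (hi == m) && (i == m) = false by lia.
  have -> : (lo + (lo != 0) <= i)%N = false by lia.
  by rewrite /=; ring.
- have -> : (lo == 0)%N && (i == 0)%N = false by lia.
  have -> : (lo + (lo != 0) <= i)%N by lia.
  have -> : (i < hi + (hi == m))%N = (i < hi)%N || (hi == m) && (i == m) by lia.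
  have [i_hi|hi_i|->] := ltngtP i hi.
  + have -> : (hi == m) && (i == m) = false by lia.
    by rewrite /=; ring.
  + have -> : (hi == m) && (i == m) = false by lia.
    by rewrite /=; ring.
  by rewrite andbb /=; case: (hi == m); rewrite /=; ring.
have -> : (hi == m) && (i == m) = false by lia.
have -> : (i < hi + (hi == m))%N by lia.
have -> : (lo + (lo != 0) <= i <= hi)%N = (lo == 0)%N by lia.
by rewrite i_lo andbb /=; case: (lo == 0)%N; rewrite /=; ring.
Qed.

Lemma A_mx_mulE k w (i : 'I_n.+1) : (1 <= k < N.+1)%N ->
  (A_mx R N p k *m w) i ord0 =
    (fwd k i)%:R * (ext w i.+1 - ext w i.+2)
    + (bwd k i)%:R * (ext w i.+1 - ext w i).
Proof.
move=> kN; rewrite mxE /ext -!sumrB !mulr_sumr -big_split /=.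
by apply: eq_bigr => j _; rewrite A_mxE //; ring.
Qed.

(** Each row has its forward edge in exactly one device, seen by telescoping over block starts. The
    [k == N] term of [f] assigns the edge leaving the last row to device [N]. *)
Lemma sum_fwd (i : 'I_n.+1) : \sum_(1 <= k < N.+1) (fwd k i)%:R = 1 :> R.
Proof.
rewrite big_add1 /=.
pose f (k : nat) : R := - (k * p <= i)%N%:R + (k == N)%:R * (n <= i)%N%:R.
rewrite (eq_big_nat _ _ (F2 := fun k => f k.+1 - f k)) => [|k /andP[_ kN]].
  rewrite telescope_sumr // /f eqxx mul0n leq0n (_ : (0%N == N) = false); last by lia.
  by rewrite /=; ring.
rewrite /f /fwd subn1 /= (_ : (k == N) = false); last by lia.
have -> : (k.+1 * p = k * p + p)%N by rewrite mulSnr.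
clear f; move: (nat_of_ord i) (ltn_ord i) => {}i; case: (eqVneq k.+1 N) => [kE|_] iN.
  have -> : (n = k * p + p)%N by rewrite -kE mulSnr.
  have -> : (i < k * p + p + true)%N by rewrite -mulSnr kE; lia.
  by rewrite andbT /=; ring.
rewrite addn0; case: (leqP (k * p) i) => ki;
  case: (ltnP i (k * p + p)) => ki' /=; try ring.
lia.
Qed.

Lemma sum_bwd (i : 'I_n.+1) : \sum_(1 <= k < N.+1) (bwd k i)%:R = 1 :> R.
Proof.
rewrite big_add1 /=.
(* The alternative [k == 0] assigns the edge before row 0, the corner correction, to device 1. *)
pose f (k : nat) : R := - ((k * p < i) || (k == 0))%N%:R.
rewrite (eq_big_nat _ _ (F2 := fun k => f k.+1 - f k)) => [|k /andP[_ kN]].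
  rewrite telescope_sumr // /f eqxx orbT.
  have -> : (N == 0)%N = false by lia.
  have -> : (N * p < i)%N = false by have := ltn_ord i; lia.
  by rewrite /=; ring.
rewrite /f /bwd subn1 /= orbF eqSS.
case: k kN => [|k] kN; first by rewrite mul0n !mul1n /= orbT; case: ltnP => _ /=; ring.
rewrite /= orbF addn1.
have : (k.+1 * p < k.+2 * p)%N by rewrite ltn_pmul2r //; lia.
case: (leqP i (k.+2 * p)) => h1; case: (ltnP (k.+1 * p) i) => h2 h3 /=; try ring.
lia.
Qed.

Lemma sum_A_mx_mulE w (i : 'I_n.+1) :
  (\sum_(1 <= k < N.+1) A_mx R N p k *m w) i ord0
  = 2 * ext w i.+1 - ext w i.+2 - ext w i.
Proof.
rewrite summxE (eq_big_nat _ _ (F2 := fun k => (fwd k i)%:R * (ext w i.+1 - ext w i.+2)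
    + (bwd k i)%:R * (ext w i.+1 - ext w i))); last by move=> k; exact: A_mx_mulE.
by rewrite big_split /= -!mulr_suml sum_fwd sum_bwd; ring.
Qed.

Lemma A_mx_sym k : (A_mx R N p k)^T = A_mx R N p k.
Proof.
rewrite /A_mx !raddfD /= !(fun_if trmx) !trmx_delta !trmx0.
congr (_ + _ + _); apply/matrixP => i j; rewrite !mxE.
have [->//|ij] := eqVneq i j.
by rewrite /= orbC [in_block _ _ && _]andbC.
Qed.

(** * Hessians, stationarity and contraction of a gradient step *)

Context (mu : R).
Definition hess k : 'M[R]_n.+1 := A_mx R N p k + mu%:M.

Lemma hess_mulE k w : hess k *m w = A_mx R N p k *m w + mu *: w.
Proof. by rewrite [LHS]mulmxDl mul_scalar_mx. Qed.

(** This exact expansion yields both the gradient and the first-order condition at a minimizer;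
    symmetry of [A_mx] merges the two cross terms. *)
Lemma ridge_objD k w u (t : R) :
  ridge_obj mu k (w + t *: u) = ridge_obj mu k w
    + t * (u^T *m (hess k *m w - b_vec R N p k)) ord0 ord0
    + t ^+ 2 * (2^-1 * (u^T *m (hess k *m u)) ord0 ord0).
Proof.
rewrite /ridge_obj !enorm_sq /hess -!mulmxA.
move: (A_mx R N p k) (A_mx_sym k) (b_vec R N p k) => A A_sym b.
pose dot (x y : 'cV[R]_n.+1) : R := (x^T *m y) ord0 ord0.
rewrite -!/(dot _ _).
have dotC x y : dot x y = dot y x.
  by rewrite /dot !mxE; apply: eq_bigr => i _; rewrite !mxE mulrC.
have dotDr x y z c : dot x (y + c *: z) = dot x y + c * dot x z.
  by rewrite /dot mulmxDr -scalemxAr !mxE.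
have dotDl x y z c : dot (y + c *: z) x = dot y x + c * dot z x.
  by rewrite dotC dotDr !(dotC x).
have dotA x y : dot x (A *m y) = dot y (A *m x).
  by rewrite dotC /dot trmx_mul A_sym mulmxA.
have dotBr x y z : dot x (y - z) = dot x y - dot x z.
  by rewrite -scaleN1r dotDr mulN1r.
rewrite dotBr !mulmxDl !mul_scalar_mx !dotDr mulmxDr -scalemxAr !dotDr !dotDl.
rewrite (dotA w u) (dotC w u) (dotC b u) (dotC b w).
by field.
Qed.

Lemma grad_ridge_obj k w :
  grad (@ridge_obj R N p mu k) w = hess k *m w - b_vec R N p k.
Proof.
apply/matrixP => i j; rewrite ord1 mxE.
apply: (@derive_quadratic _ _ _ _ _ _ _) => t.
  rewrite ridge_objD trmx_delta; congr (_ + _ * _ + _).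
  by rewrite -rowE !mxE.
Qed.

Lemma minimizer_stationary w :
    is_minimizer (global_obj N (@ridge_obj R N p mu)) w ->
  \sum_(1 <= k < N.+1) (hess k *m w - b_vec R N p k) = 0.
Proof.
move=> w_min; set S := \sum_(1 <= k < N.+1) _.
suff dot0 (u : 'cV[R]_n.+1) : (u^T *m S) ord0 ord0 = 0.
  apply/matrixP => i j; rewrite ord1 [RHS]mxE -(dot0 (delta_mx i ord0)).
  by rewrite trmx_delta -rowE mxE.
pose Q := \sum_(1 <= k < N.+1) 2^-1 * (u^T *m (hess k *m u)) ord0 ord0.
apply: (@linear_coef_eq0 _ _ Q) => t.
have := w_min (w + t *: u); rewrite /global_obj ler_pM2l ?invr_gt0 ?ltr0n; last by lia.
under [leRHS]eq_bigr do rewrite ridge_objD -addrA.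
by rewrite big_split /= lerDl big_split /= /S mulmx_sumr summxE !mulr_sumr.
Qed.

(** In a row with [s <= 2] edges the step has diagonal coefficient [1 - eta * (s + mu)], nonnegative
    by the bound on [eta], and [s] coefficients [eta]. These add up to [1 - eta * mu]. *)
Lemma gradient_step_contraction k (eta : R) w : (1 <= k < N.+1)%N ->
    0 <= eta -> eta * (2 + mu) <= 1 ->
  `|w - eta *: (hess k *m w)| <= (1 - eta * mu) * `|w|.
Proof.
move=> kN eta0 eta1; apply: ler_mx_norm => i j; rewrite ord1.
have := A_mx_mulE w i kN; rewrite ext_ord.
rewrite hess_mulE; move: (A_mx R N p k *m w) => v vE; rewrite !mxE vE.
have := ler_norm_ext w i.+2; have := ler_norm_ext w i; have := ler_norm_entry w i ord0.
set x := w i ord0; set y := ext w i; set z := ext w i.+2; set M := `|w|.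
rewrite !ler_norml => /andP[x1 x2] /andP[y1 y2] /andP[z1 z2].
(* These products are the nonlinear certificates from which every case of [fwd] and [bwd] follows
   linearly. *)
have etax1 : 0 <= (1 - eta * (2 + mu)) * (M - x) by rewrite mulr_ge0 ?subr_ge0.
have etax2 : 0 <= (1 - eta * (2 + mu)) * (M + x).
  by rewrite mulr_ge0 ?subr_ge0 //; lra.
have ex1 : 0 <= eta * (M - x) by rewrite mulr_ge0 ?subr_ge0.
have ex2 : 0 <= eta * (M + x) by rewrite mulr_ge0 //; lra.
have ey1 : 0 <= eta * (M - y) by rewrite mulr_ge0 ?subr_ge0.
have ey2 : 0 <= eta * (M + y) by rewrite mulr_ge0 //; lra.
have ez1 : 0 <= eta * (M - z) by rewrite mulr_ge0 ?subr_ge0.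
have ez2 : 0 <= eta * (M + z) by rewrite mulr_ge0 //; lra.
by case: fwd; case: bwd; rewrite /=; lra.
Qed.

Lemma fwd1 i : fwd 1 i = (i < p)%N.
Proof. by rewrite /fwd subnn mul0n mul1n (_ : (1 == N)%N = false) ?addn0 //; lia. Qed.

Lemma bwd1 i : bwd 1 i = (i <= p)%N.
Proof. by rewrite /bwd subnn mul0n mul1n. Qed.

(** Rows before the first junction belong to device 1 alone, so there [A_mx 1] acts as the full
    tridiagonal matrix. *)
Lemma A_mx_mul_first_block k w (i : 'I_n.+1) : (1 <= k < N.+1)%N -> (i < p)%N ->
  (A_mx R N p k *m w) i ord0
  = (k == 1%N)%:R * (2 * ext w i.+1 - ext w i.+2 - ext w i).
Proof.
move=> kN ip; rewrite A_mx_mulE //; have [->|k1] := eqVneq k 1%N.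
  by rewrite fwd1 bwd1 ip (ltnW ip) /=; ring.
have pk : (p <= (k - 1) * p)%N by rewrite leq_pmull //; lia.
have -> : fwd k i = false by rewrite /fwd; lia.
have -> : bwd k i = false by rewrite /bwd; lia.
by rewrite !mul0r addr0.
Qed.

Lemma b_vecE k (i : 'I_n.+1) :
  b_vec R N p k i ord0 = (k == 1%N)%:R * ((i : nat) == 0%N)%:R.
Proof.
by rewrite /b_vec; case: (k == 1%N); rewrite !mxE ?mul0r // mul1r andbT.
Qed.

Local Notation lam := (N%:R * mu).

Lemma sum_hess_mulE w (i : 'I_n.+1) :
  (\sum_(1 <= k < N.+1) hess k *m w) i ord0
  = (2 + lam) * ext w i.+1 - ext w i.+2 - ext w i.
Proof.
under eq_bigr do rewrite hess_mulE.
rewrite big_split /= sumr_const_nat subn1 /= -[(mu *: w) *+ _]scaler_nat scalerA.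
have := sum_A_mx_mulE w i; move: (\sum_(1 <= k < N.+1) _) => v vE.
by rewrite !mxE vE -ext_ord; ring.
Qed.

Lemma ler_norm_sum_hess w (i : 'I_n.+1) : 0 < mu ->
  `|(\sum_(1 <= k < N.+1) hess k *m w) i ord0| <= (4 + lam) * `|w|.
Proof.
move=> mu0; have lam0 : 0 <= 2 + lam by rewrite addr_ge0 ?mulr_ge0 // ltW.
rewrite sum_hess_mulE; apply: le_trans (ler_normB _ _) _.
have -> : (4 + lam) * `|w| = (2 + lam) * `|w| + `|w| + `|w| by ring.
rewrite lerD ?ler_norm_ext //; apply: le_trans (ler_normB _ _) _.
by rewrite lerD ?ler_norm_ext // normrM ger0_norm // ler_wpM2l ?ler_norm_ext.
Qed.

(** * The minimizer near the junction of blocks 1 and 2 *)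

Section Stationary.
Context (w : 'cV[R]_n.+1) (hmu : 0 < mu).
Context (stat : \sum_(1 <= k < N.+1) (hess k *m w - b_vec R N p k) = 0).
Local Notation r k := (hess k *m w - b_vec R N p k).

Lemma stationary_row (i : 'I_n.+1) :
  (2 + lam) * ext w i.+1 - ext w i.+2 - ext w i = ((i : nat) == 0%N)%:R.
Proof.
have sum_b : (\sum_(1 <= k < N.+1) b_vec R N p k) i ord0 = ((i : nat) == 0%N)%:R.
  rewrite summxE; under eq_bigr do rewrite b_vecE.
  rewrite -mulr_suml big_ltn /=; last by lia.
  rewrite big_nat big1 ?addr0 ?mul1r // => k /andP[k1 _].
  by rewrite (_ : (k == 1)%N = false) //; lia.
move: stat; rewrite sumrB => /subr0_eq sumE; by rewrite -sum_b -sumE sum_hess_mulE.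
Qed.

Lemma decreasing_coords i : (0 < i <= n.+1)%N -> 0 <= ext w i.+1 < ext w i.
Proof.
move=> /andP[i0 iN].
(* The unit added at index 0 turns the source [e_1] into the boundary value [U 0 = 1] of a
   homogeneous recurrence. *)
pose U (j : nat) : R := (j == 0%N)%:R + ext w j.
have := @decreasing_recurrence R lam U n.+1 _ _ _ _ i iN; rewrite /U /=.
rewrite (_ : (i == 0)%N = false) ?add0r; last by lia.
apply.
- by rewrite mulr_ge0 // ltW.
- by rewrite ext0 addr0.
- by rewrite ext_out.
move=> j jn; have := stationary_row (Ordinal jn); rewrite /= !add0r => <-.
by ring.
Qed.

Lemma drop_gt0 : 0 <= ext w p.+2 < ext w p.+1.
Proof. by apply: decreasing_coords; rewrite /= ltnS leq_pmull //; lia. Qed.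

Let p_le : (p < n)%N. Proof. by rewrite -[X in (X < _)%N]mul1n ltn_pmul2r; lia. Qed.
(** Counting from 0, [i2] is the junction row, [i1] the row before it, whose equation is exploited,
    and [i0] the one before that. *)
Let i0 : 'I_n.+1 := inord p.-2.
Let i1 : 'I_n.+1 := inord p.-1.
Let i2 : 'I_n.+1 := inord p.

(** Here the equation of device 1 and the global one differ only in the ridge coefficient, [mu]
    against [lam]. *)
Lemma residual_first_block (i : 'I_n.+1) : (i < p)%N ->
  (r 1) i ord0 = (mu - lam) * ext w i.+1.
Proof.
move=> ip; rewrite hess_mulE; have := A_mx_mul_first_block w (k := 1) _ ip.
move/(_ ltac:(lia)); have := b_vecE 1 i.
move: (_ *m w) (b_vec _ _ _ _) => v b bE vE.
by rewrite !mxE bE vE eqxx -(stationary_row i) -ext_ord /=; ring.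
Qed.

Lemma residual_junction :
  (r 1) i2 ord0 = ext w p.+1 - ext w p + mu * ext w p.+1.
Proof.
have i2E : i2 = p :> nat by rewrite inordK //; lia.
rewrite hess_mulE; have := A_mx_mulE w i2 (k := 1) ltac:(lia).
have := b_vecE 1 i2; move: (_ *m w) (b_vec _ _ _ _) => v b bE vE.
rewrite !mxE bE vE -ext_ord fwd1 bwd1 i2E ltnn leqnn.
by rewrite (_ : (p == 0)%N = false) /=; [ring|lia].
Qed.

Lemma drift_lower_bound :
  (ext w p.+1 - ext w p.+2) * (1 + lam ^+ 2 + lam ^+ 3 / 2)
  <= (\sum_(1 <= k < N.+1) hess k *m r k) i1 ord0.
Proof.
have i0E : i0 = p.-2 :> nat by rewrite inordK //; lia.
have i1E : i1 = p.-1 :> nat by rewrite inordK //; lia.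
have i2E : i2 = p :> nat by rewrite inordK //; lia.
have -> : (\sum_(1 <= k < N.+1) hess k *m r k) i1 ord0
    = 2 * ext (r 1) p - ext (r 1) p.+1 - ext (r 1) p.-1.
  (* The [mu] part vanishes because the residuals sum to zero, and only device 1 has a nonzero row
     [i1]; what remains is row [i1] of [A_mx 1] applied to [r 1]. *)
  under eq_bigr do rewrite hess_mulE.
  rewrite big_split /= -scaler_sumr stat scaler0 addr0 summxE big_ltn; last by lia.
  rewrite big_nat big1 => [|k /andP[k1 kN]]; last first.
    rewrite A_mx_mul_first_block; [|lia|lia].
    by rewrite (_ : (k == 1)%N = false) ?mul0r //; lia.
  rewrite A_mx_mul_first_block; [|lia|lia].
  by rewrite eqxx mul1r addr0 i1E prednK //; lia.
have first (i : 'I_n.+1) : (i < p)%N -> ext (r 1) i.+1 = (mu - lam) * ext w i.+1.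
  by move=> ip; rewrite [LHS]ext_ord residual_first_block.
have := first i1; rewrite i1E prednK; last by lia.
move=> /(_ ltac:(lia)) rp.
have := first i0; rewrite i0E (_ : p.-2.+1 = p.-1); last by lia.
move=> /(_ ltac:(lia)) rp0.
have rp2 : ext (r 1) p.+1 = ext w p.+1 - ext w p + mu * ext w p.+1.
  by rewrite -residual_junction -ext_ord i2E.
have row1 := stationary_row i1; rewrite i1E prednK in row1; last by lia.
have row2 := stationary_row i2; rewrite i2E in row2.
rewrite (_ : (p == 0)%N = false) in row2; last by lia.
rewrite (_ : (p.-1 == 0)%N = false) in row1; last by lia.
have /andP[c0 cb] := drop_gt0.
rewrite rp rp0 rp2.
move: (ext w p.-1) (ext w p) (ext w p.+1) (ext w p.+2) row1 row2 c0 cb.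
clear rp rp0 rp2 => e a b c row1 row2 c0 cb.
(* This is where [N >= 2] enters. The recurrence then eliminates [a] and [e], and the gap becomes a
   sum of products of nonnegative factors in [l], [mu], [b] and [c]. *)
have mu2 : 2 * mu <= lam by rewrite ler_wpM2r ?ler_nat // ltW.
move: lam mu2 row1 row2 => l mu2 row1 row2.
have aE : a = (2 + l) * b - c by rewrite /= in row2; lra.
have eE : e = (2 + l) * a - b by rewrite /= in row1; lra.
have l0 : 0 < l by apply: lt_le_trans mu2; rewrite mulr_gt0.
rewrite -subr_ge0.
have -> : 2 * ((mu - l) * a) - (b - a + mu * b) - (mu - l) * e
    - (b - c) * (1 + l ^+ 2 + l ^+ 3 / 2)
   = (l - 2 * mu) / 2 * l * (l * b + b + (b - c)) + l ^+ 2 / 2 * (1 + l) * c.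
  by rewrite eE aE; field.
apply: addr_ge0; apply: mulr_ge0 => //.
- by apply: mulr_ge0; [lra | exact: ltW].
- by have : 0 <= l * b; [apply: mulr_ge0; lra | lra].
by apply: mulr_ge0; [rewrite mulr_ge0 // sqr_ge0 | lra].
Qed.

Lemma enorm_A1A2_sq :
  enorm (A_mx R N p 1 *m A_mx R N p 2 *m w) ^+ 2
  = 2 * (ext w p.+1 - ext w p.+2) ^+ 2.
Proof.
have i1E : i1 = p.-1 :> nat by rewrite inordK //; lia.
have i2E : i2 = p :> nat by rewrite inordK //; lia.
set d := ext w p.+1 - ext w p.+2.
rewrite -mulmxA; set v := A_mx R N p 2 *m w.
(* Rows of [v] after the junction are irrelevant, since [A_mx 1] does not read them; up to the
   junction only the forward edge of row [p] survives. *)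
have vE (i : 'I_n.+1) : (i <= p)%N -> v i ord0 = (i == p :> nat)%:R * d.
  move=> ip; rewrite A_mx_mulE; last by lia.
  have -> : fwd 2 i = (i == p :> nat) by rewrite /fwd; nia.
  have -> : bwd 2 i = false by rewrite /bwd; lia.
  by rewrite mul0r addr0; have [->|_] := eqVneq (i : nat) p; rewrite ?mul0r.
have extv j : (j <= p.+1)%N -> ext v j = (j == p.+1)%:R * d.
  case: j => [|j] jp; first by rewrite ext0 mul0r.
  have jn : (j < n.+1)%N by lia.
  by rewrite (ext_ord v (Ordinal jn)) vE.
have uE (i : 'I_n.+1) : (A_mx R N p 1 *m v) i ord0
    = ((i == p :> nat)%:R - (i == p.-1 :> nat)%:R) * d.
  rewrite A_mx_mulE; last by lia.
  rewrite fwd1 bwd1; case: (ltngtP i p) => ip /=.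
  - rewrite !extv; [|lia..].
    have -> : (i.+2 == p.+1) = (i == p.-1 :> nat) by lia.
    have -> : (i.+1 == p.+1) = false by lia.
    have -> : (i == p.+1 :> nat) = false by lia.
    by rewrite /=; ring.
  - have -> : (i == p.-1 :> nat) = false by lia.
    by rewrite /=; ring.
  rewrite mul0r add0r !extv; [|lia..]; rewrite ip eqxx.
  have -> : (p == p.+1) = false by lia.
  have -> : (p == p.-1) = false by lia.
  by rewrite /=; ring.
rewrite enorm_sq mxE (bigD1 i1) //= (bigD1 i2) /=; last first.
  by rewrite -val_eqE /= i1E i2E; lia.
rewrite big1 => [|i /andP[]]; last first.
  rewrite -!val_eqE /= i1E i2E => ni1 ni2.
  by rewrite uE (negbTE ni1) (negbTE ni2) subrr mul0r mulr0.
rewrite !(mxE trmx_key) !uE i1E i2E !eqxx.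
have -> : (p.-1 == p) = false by lia.
have -> : (p == p.-1) = false by lia.
by rewrite /=; ring.
Qed.

(** The factor 8 is 16 divided by the 2 in ['C(E, 2) = E * (E - 1) / 2]. *)
Lemma drift_gap : exists i : 'I_n.+1,
  (4 + lam) * enorm (A_mx R N p 1 *m A_mx R N p 2 *m w)
  < 8 * (\sum_(1 <= k < N.+1) hess k *m r k) i ord0.
Proof.
exists i1; have := drift_lower_bound; have := enorm_A1A2_sq.
have d0 : 0 < ext w p.+1 - ext w p.+2 by rewrite subr_gt0; case/andP: drop_gt0.
have e0 : 0 <= enorm (A_mx R N p 1 *m A_mx R N p 2 *m w) by exact: sqrtr_ge0.
move: d0 e0; move: (ext w p.+1 - _) (enorm _) (_ i1 ord0) => d e v d0 e0 eE vE.
have lam0 : 0 <= lam by rewrite mulr_ge0 // ltW.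
move: lam lam0 vE => l l0 vE.
(* A rational bound for [sqrt 2] that leaves a strictly positive polynomial in [l]. *)
have e_le : e <= 3 / 2 * d.
  rewrite -ler_sqr ?nnegrE //; last by rewrite mulr_ge0 //; lra.
  by rewrite eE; have := sqr_ge0 d; lra.
have : (4 + l) * e <= (4 + l) * (3 / 2 * d) by rewrite ler_wpM2l //; lra.
suff : (4 + l) * (3 / 2 * d) < 8 * (d * (1 + l ^+ 2 + l ^+ 3 / 2)) by lra.
rewrite -subr_gt0.
have -> : 8 * (d * (1 + l ^+ 2 + l ^+ 3 / 2)) - (4 + l) * (3 / 2 * d)
  = d * (7 * l ^+ 2 + (l - 3 / 4) ^+ 2 + 23 / 16 + 4 * l ^+ 3) by field.
rewrite mulr_gt0 //; have := sqr_ge0 l; have := sqr_ge0 (l - 3 / 4).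
by have := exprn_ge0 3 l0; lra.
Qed.

Lemma A1A2_neq0 : 0 < enorm (A_mx R N p 1 *m A_mx R N p 2 *m w).
Proof.
rewrite lt_neqAle sqrtr_ge0 andbT eq_sym -sqrf_eq0 enorm_A1A2_sq.
by rewrite mulf_neq0 // sqrf_eq0 subr_eq0 gt_eqF //; case/andP: drop_gt0.
Qed.
End Stationary.

End Ridge.

(** * Choice of the threshold and conclusion *)

Unset Implicit Arguments.

Theorem theorem5 (R : realType) (N p : nat) (mu : R)
    (hN : (1 < N)%N) (hp : (1 < p)%N) (hmu : 0 < mu)
    (wstar : 'cV[R]_(N * p).+1)
    (hwstar : is_minimizer (global_obj N (@ridge_obj R N p mu)) wstar) :
  (exists eta0 : R, 0 < eta0 /\
     forall eta : R, 0 < eta -> eta <= eta0 ->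
     forall w0 : 'cV[R]_(N * p).+1,
       fedavg N (@ridge_obj R N p mu) 1 eta w0 @ \oo --> wstar)
  /\
  (forall E : nat, (1 < E)%N ->
   exists eta0 : R, 0 < eta0 /\
     forall eta : R, 0 < eta -> eta <= eta0 ->
     exists wtilde : 'cV[R]_(N * p).+1,
       (forall w0 : 'cV[R]_(N * p).+1,
          fedavg N (@ridge_obj R N p mu) E eta w0 @ \oo --> wtilde)
       /\ wtilde <> wstar
       /\ (E - 1)%:R * eta / 16
            * enorm (A_mx R N p 1 *m A_mx R N p 2 *m wstar)
          <= enorm (wtilde - wstar)).
Proof.
have N0 : (0 < N)%N by lia.
have stat := minimizer_stationary hN hp hwstar.
have mu2 : 0 < 2 + mu by lra.
have contr eta : 0 < eta -> eta <= (2 + mu)^-1 ->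
    [/\ 0 <= 1 - eta * mu, 1 - eta * mu < 1 &
     forall k (x : 'cV[R]_(N * p).+1), (1 <= k < N.+1)%N ->
     `|x - eta *: (@hess R N p mu k *m x)| <= (1 - eta * mu) * `|x|].
  move=> eta0; rewrite -[leRHS]mul1r ler_pdivlMr // => eta1.
  have em := mulr_gt0 eta0 hmu; split; [lra | lra | move=> k x kN].
  exact: (gradient_step_contraction hN hp x kN (ltW eta0) eta1).
split.
  exists (2 + mu)^-1; split=> [|eta eta0 eta1 w0]; first by rewrite invr_gt0.
  have [q0 q1 step] := contr eta eta0 eta1.
  apply: (fedavg_cvg (grad_ridge_obj mu) N0 _ q0 q1 step) => //.
  by under eq_bigr do rewrite geom1 mul1mx.
move=> E hE; have E0 : (0 < E)%N by lia.
pose h : R := \sum_(1 <= k < N.+1) `|@hess R N p mu k|.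
have hess_le k : (1 <= k < N.+1)%N -> `|@hess R N p mu k| <= h.
  move=> kN; rewrite /h (bigD1_seq k) ?mem_index_iota ?iota_uniq //=.
  by rewrite lerDl sumr_ge0.
have [C [C0 expansion]] := fixed_point_expansion N0 E hess_le stat.
have [i gap] := drift_gap hN hp hmu stat.
have e_gt0 := A1A2_neq0 hN hp hmu stat.
move: gap e_gt0; set e := enorm _; set V := \sum_(1 <= k < N.+1) _.
move=> gap e_gt0; pose lam : R := N%:R * mu.
have E1 : 0 < (E - 1)%:R :> R by rewrite ltr0n; lia.
pose tau : R := (E - 1)%:R / 16 * e.
have tau0 : 0 < tau by rewrite mulr_gt0 // divr_gt0.
have binE : 'C(E, 2)%:R * 2 = E%:R * (E - 1)%:R :> R.
  by rewrite -!natrM mulnC -mul_bin_diag bin1 subn1.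
(* Here [tau * eta] is the claimed bound, and [delta] is the gap, per unit of [eta], between the
   drift and the largest left-hand side possible when [|z| <= tau * eta]. *)
pose delta : R := 'C(E, 2)%:R * V i ord0 - E%:R * (4 + lam) * tau.
have delta0 : 0 < delta.
  have -> : delta = E%:R * (E - 1)%:R / 16 * (8 * V i ord0 - (4 + lam) * e).
    by rewrite /delta /tau; have -> : 'C(E, 2)%:R = E%:R * (E - 1)%:R / 2 :> R;
      [rewrite -binE mulfK | field].
  by rewrite mulr_gt0 ?subr_gt0 // divr_gt0 // mulr_gt0 // ltr0n.
pose D := C * (1 + tau) + 1.
have D0 : 0 < D by rewrite ltr_wpDl // mulr_ge0 //; lra.
(* The three bounds serve the expansion, the contraction, and the requirement that the error
   [C * (1 + tau) * eta] stay below [delta]; the [+ 1] in [D] makes this strict even if [C = 0]. *)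
exists (Num.min (Num.min 1 (2 + mu)^-1) (delta / D)); split=> [|eta eta0].
  by rewrite !lt_min ltr01 invr_gt0 mu2 divr_gt0.
rewrite !le_min => /andP[/andP[eta_le1 eta_mu] eta_delta].
have [q0 q1 step] := contr eta eta0 eta_mu.
have [wt wt_fix] := fixed_point_exists (grad_ridge_obj mu) N0 E0 q1 step.
exists wt; split=> [w0|].
  exact: (fedavg_cvg (grad_ridge_obj mu) N0 E0 q0 q1 step w0 wt_fix).
have bound : tau * eta <= enorm (wt - wstar).
  (* If the distance were smaller, the error in row [i] would be at most [C * (1 + tau) * eta ^+ 2],
     and dividing by [eta] would contradict the choice of threshold. *)
  rewrite leNgt; apply/negP => small.
  set z := wt - wstar in small.
  have z_small : `|z| < tau * eta := le_lt_trans (ler_norm_enorm z) small.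
  have := expansion eta z (ltW eta0) eta_le1.
  rewrite /z subrKC -/z => /(_ wt_fix) => /(le_trans (ler_norm_entry _ i ord0)).
  have := ler_norm_sum_hess hN hp z i hmu.
  rewrite -/V -/lam; move: (\sum_(1 <= k < N.+1) _) => S S_le.
  rewrite -[leLHS]normrN => /(le_trans (ler_norm _)).
  rewrite !mxE => main.
  have {}S_le : S i ord0 <= (4 + lam) * (tau * eta).
    apply: le_trans (ler_norm _) _; apply: le_trans S_le _; rewrite ler_wpM2l ?ltW //.
    by rewrite addr_gt0 // mulr_gt0 // ltr0n.
  have ES_le := ler_wpM2l (ler0n R E) S_le.
  have Cz : C * (eta ^+ 2 + eta * `|z|) <= C * (eta ^+ 2 + eta * (tau * eta)).
    by rewrite ler_wpM2l // lerD2l ler_wpM2l // ltW.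
  have : eta * delta <= eta * (C * (1 + tau) * eta).
    have -> : eta * delta = eta * 'C(E, 2)%:R * V i ord0
        - E%:R * ((4 + lam) * (tau * eta)) by rewrite /delta; ring.
    have -> : eta * (C * (1 + tau) * eta) = C * (eta ^+ 2 + eta * (tau * eta)) by ring.
    lra.
  rewrite ler_pM2l // leNgt => /negP; apply.
  by apply: lt_le_trans (_ : D * eta <= _); [rewrite /D mulrDl mul1r ltrDl |
    rewrite mulrC -ler_pdivlMr].
split; last by rewrite [leLHS](_ : _ = tau * eta) // /tau; ring.
move=> wtE; move: bound; rewrite wtE subrr.
suff -> : enorm (0 : 'cV[R]_(N * p).+1) = 0 by rewrite leNgt mulr_gt0.
by rewrite /enorm big1 ?sqrtr0 // => j _; rewrite mxE expr0n.
Qed.
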